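(* Let $(X,d)$ be a complete separable metric space and let $G \leq \mathrm{Iso}(X)$ be a closed subgroup. Assume that $X /\!\!/ G$ is a proper metric space. Then the following are equivalent: (1) The group $G$ is locally Roelcke precompact and the action $G \curvearrowright X$ is coarsely proper. (2) The quotient $X^n /\!\!/ G$ is a proper metric space for every $n \in \mathbb{N}$. (3) For every $x \in X$ and $r > 0$, the set $O = \{g \in G : d(x,gx) < r\}$ is Roelcke precompact.
   Context: $\mathrm{Iso}(X)$ is the isometry group of $X$ with the topology of pointwise convergence. For a group $G$ acting by isometries on a metric space $Y$, $Y /\!\!/ G$ denotes the set of orbit closures $[y]=\overline{Gy}$, $y \in Y$, equipped with the metric $d([x],[y]) = \inf_{g\in G} d(x,gy)$ (the distance between the sets). Finite products $X^n$ carry the maximum metric $d(x,y)=\max_i d(x_i,y_i)$ and the diagonal action of $G$. A metric space is proper if all closed bounded sets are compact. For a topological group $G$: a subset $A\subseteq G$ is Roelcke precompact if for every neighbourhood $U$ of the identity there is a finite $F\subseteq G$ with $A\subseteq UFU$; $G$ is locally Roelcke precompact if it has a Roelcke precompact neighbourhood of the identity. A subset $B\subseteq G$ is coarsely bounded if it is bounded for every continuous left-invariant pseudo-metric on $G$. An isometric action $G\curvearrowright X$ is coarsely proper if for every $r>0$ and every (equivalently, some) $x\in X$, the set $\{g\in G : d(gx,x)<r\}$ is coarsely bounded. *)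

(* Defs.v *)
From HB Require Import structures.
From mathcomp Require Import all_boot all_order all_algebra.
From mathcomp Require Import all_classical all_reals all_analysis.

Set Implicit Arguments.
Unset Strict Implicit.
Unset Printing Implicit Defensive.

Import Order.TTheory GRing.Theory Num.Theory.
Import numFieldNormedType.Exports.

Local Open Scope classical_set_scope.
Local Open Scope ring_scope.

Local Obligation Tactic := idtac.

(* The library's completeType is pointed; this version also covers the empty
   space. *)
Definition complete_space (T : uniformType) : Prop :=
  forall F : set_system T, ProperFilter F -> cauchy F -> exists x : T, F --> x.

Definition separable_space (T : topologicalType) : Prop :=
  exists2 D : set T, countable D & dense D.

Definition metric_bounded (R : realType) (Y : metricType R) (A : set Y) : Prop :=
  exists M : R, forall x y, A x -> A y -> mdist x y <= M.

Definition proper_space (R : realType) (Y : metricType R) : Prop :=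
  forall A : set Y, closed A -> metric_bounded A -> compact A.

HB.mixin Record isTopologicalGroup G & Group G & Topological G := {
  mulg_continuous : continuous (fun x : G * G => (x.1 * x.2)%g);
  invg_continuous : continuous (fun x : G => x^-1%g)
}.

#[short(type="topologicalGroupType")]
HB.structure Definition TopologicalGroup :=
  { G of Group G & Topological G & isTopologicalGroup G }.

Section subgroup_topology.
Variables (T : topologicalGroupType) (G : groupClosed T).

Definition subgroup : Type := {g : T | g \in G}.

HB.instance Definition _ := [isSub of subgroup for @sval T (fun g => g \in G)].
HB.instance Definition _ := [Choice of subgroup by <:].

Fact subgroup_group_closed : group_closed G.
Proof.
split; first exact: gpred1.
by move=> x y xG yG; exact: gpredF.
Qed.

HB.instance Definition _ :=
  SubChoice_isSubGroup.Build T (fun g => g \in G) subgroup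
    subgroup_group_closed.

HB.instance Definition _ :=
  Topological.copy subgroup (initial_topology (val : subgroup -> T)).

Lemma subgroup_val_continuous : continuous (val : subgroup -> T).
Proof. exact: initial_continuous. Qed.

Fact subgroup_mulg_continuous :
  continuous (fun x : subgroup * subgroup => (x.1 * x.2)%g).
Proof.
apply: (@continuous_comp_initial subgroup _ T val) => -[x y] /=.
rewrite (_ : val \o _ =
  (fun z : T * T => (z.1 * z.2)%g) \o
  (fun z : subgroup * subgroup => (val z.1, val z.2))); last first.
  by apply/funext.
apply: (@continuous_comp _ (T * T)%type T); last exact: mulg_continuous.
apply: cvg_pair => /=.
- by apply: (@cvg_comp _ _ _ fst val); [exact: cvg_fst|exact: subgroup_val_continuous].
- by apply: (@cvg_comp _ _ _ snd val); [exact: cvg_snd|exact: subgroup_val_continuous].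
Qed.

Fact subgroup_invg_continuous : continuous (fun x : subgroup => x^-1%g).
Proof.
apply: (@continuous_comp_initial subgroup _ T val) => x.
rewrite (_ : val \o _ = (fun z : T => z^-1%g) \o val); last first.
  by apply/funext => z /=.
apply: continuous_comp; first exact: subgroup_val_continuous.
exact: invg_continuous.
Qed.

HB.instance Definition _ := isTopologicalGroup.Build subgroup
  subgroup_mulg_continuous subgroup_invg_continuous.

End subgroup_topology.

Section coarse_notions.
Variable G : topologicalGroupType.

Definition roelcke_precompact (A : set G) : Prop :=
  forall U : set G, nbhs 1%g U ->
    exists2 F : set G, finite_set F &
      A `<=` [set (p.1.1 * p.1.2 * p.2)%g | p in (U `*` F) `*` U].

Definition locally_roelcke_precompact : Prop :=
  exists2 V : set G, nbhs 1%g V & roelcke_precompact V.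

Variable R : realType.

Record pseudometric (T : Type) (d : T -> T -> R) : Prop := Pseudometric {
  pseudometric_ge0 : forall x y, 0 <= d x y;
  pseudometricxx : forall x, d x x = 0;
  pseudometric_sym : forall x y, d x y = d y x;
  pseudometric_triangle : forall x y z, d x z <= d x y + d y z
}.

Definition left_invariant (d : G -> G -> R) : Prop :=
  forall g x y, d (g * x)%g (g * y)%g = d x y.

Definition coarsely_bounded (B : set G) : Prop :=
  forall d : G -> G -> R,
    pseudometric d -> left_invariant d ->
    continuous (fun p : G * G => d p.1 p.2) ->
    exists M : R, forall x y, B x -> B y -> d x y <= M.

End coarse_notions.

Section isometries.
Variables (R : realType) (X : metricType R).

(* Isometries are bijective: injectivity follows from the preservation of
   distances. The group law is composition, and the topology, given below, is
   that of pointwise convergence. *)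
Record isometry_group : Type := Isometry {
  isom_fun :> X -> X;
  isom_dist : forall x y, mdist (isom_fun x) (isom_fun y) = mdist x y;
  isom_surj : forall y, exists x, isom_fun x = y
}.

Lemma isometryP (f g : isometry_group) : (forall x, f x = g x) -> f = g.
Proof.
case: f g => [f fd fs] [g gd gs] /= /funext fg; case: g / fg in gd gs *.
by congr Isometry; exact: Prop_irrelevance.
Qed.

HB.instance Definition _ := gen_eqMixin isometry_group.
HB.instance Definition _ := gen_choiceMixin isometry_group.

Program Definition isom_id : isometry_group := @Isometry idfun _ _.
Next Obligation. by []. Qed.
Next Obligation. by move=> y; exists y. Qed.

Program Definition isom_comp (f g : isometry_group) : isometry_group :=
  @Isometry (f \o g) _ _.
Next Obligation. by move=> f g x y /=; rewrite !isom_dist. Qed.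
Next Obligation.
by move=> f g z; have [y <-] := isom_surj f z; have [x <-] := isom_surj g y; exists x.
Qed.

Definition isom_inv_fun (f : isometry_group) (y : X) : X := projT1 (cid (isom_surj f y)).

Lemma isom_inv_funK f : cancel (isom_inv_fun f) f.
Proof. by move=> y; rewrite /isom_inv_fun; case: cid. Qed.

Lemma isom_inj (f : isometry_group) : injective f.
Proof.
by move=> x y fxy; apply: mdist_positivity; rewrite -(isom_dist f) fxy mdistxx.
Qed.

Program Definition isom_inv (f : isometry_group) : isometry_group :=
  @Isometry (isom_inv_fun f) _ _.
Next Obligation. by move=> f x y; rewrite -(isom_dist f) !isom_inv_funK. Qed.
Next Obligation.
by move=> f x; exists (f x); apply: (@isom_inj f); rewrite isom_inv_funK.
Qed.

Fact isom_compA : associative isom_comp.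
Proof. by move=> f g h; apply: isometryP. Qed.

Fact isom_comp1f : left_id isom_id isom_comp.
Proof. by move=> f; apply: isometryP. Qed.

Fact isom_compf1 : right_id isom_id isom_comp.
Proof. by move=> f; apply: isometryP. Qed.

Fact isom_compVf : left_inverse isom_id isom_inv isom_comp.
Proof.
by move=> f; apply: isometryP => x; apply: (@isom_inj f); rewrite /= isom_inv_funK.
Qed.

Fact isom_compfV : right_inverse isom_id isom_inv isom_comp.
Proof. by move=> f; apply: isometryP => x; rewrite /= isom_inv_funK. Qed.

HB.instance Definition _ := isGroup.Build isometry_group
  isom_compA isom_comp1f isom_compf1 isom_compVf isom_compfV.

Lemma isom1E x : (1%g : isometry_group) x = x. Proof. by []. Qed.

Lemma isomME (f g : isometry_group) x : (f * g)%g x = f (g x). Proof. by []. Qed.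

Lemma isomVK (f : isometry_group) : cancel (f^-1)%g f.
Proof. exact: isom_inv_funK. Qed.

HB.instance Definition _ := Topological.copy isometry_group
  (initial_topology (isom_fun : isometry_group -> {ptws X -> X})).

Lemma isom_eval_continuous x : continuous (fun f : isometry_group => f x).
Proof.
move=> f.
apply: (@continuous_comp isometry_group {ptws X -> X} X isom_fun (@^~ x)).
  exact: initial_continuous.
exact: (@proj_continuous X (fun=> X) x).
Qed.

Lemma continuous_isometry (S : topologicalType) (h : S -> isometry_group) :
  (forall x, continuous (fun s => h s x)) -> continuous h.
Proof.
move=> hc; apply: (@continuous_comp_initial isometry_group S {ptws X -> X} isom_fun).
move=> s; apply/cvg_sup => x; apply/cvg_image.
  by rewrite eqEsubset; split => // y _; exists (fun=> y).
move=> A /(hc x s) hA; exists [set f | A (f x)] => //.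
by rewrite eqEsubset; split => [_ [f ? <-]//|y Ay]; exists (fun=> y).
Qed.

Import metricType_numDomainType.

Lemma isom_eval_near (x : X) (f : isometry_group) (e : R) : 0 < e ->
  nbhs f [set f' : isometry_group | mdist (f x) (f' x) < e].
Proof.
move=> e0; apply: (@isom_eval_continuous x f [set y | mdist (f x) y < e]).
by rewrite -(ballEmdist (f x) e); exact: nbhsx_ballx.
Qed.

Fact isom_mulg_continuous :
  continuous (fun f : isometry_group * isometry_group => (f.1 * f.2)%g).
Proof.
apply: continuous_isometry => x [f g] /=; apply/cvgrPdist_lt => e e0.
have e20 : 0 < e / 2 by rewrite divr_gt0.
exists ([set f' : isometry_group | mdist (f (g x)) (f' (g x)) < e / 2],
        [set g' : isometry_group | mdist (g x) (g' x) < e / 2]); first by split; exact: isom_eval_near.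
move=> [f' g'] [/= nf' ng']; change (mdist (f (g x)) (f' (g' x)) < e).
apply: le_lt_trans (metric_triangle _ (f' (g x)) _) _.
by rewrite isom_dist (splitr e) ltrD.
Qed.

Fact isom_invg_continuous : continuous (fun f : isometry_group => f^-1%g).
Proof.
apply: continuous_isometry => x f A; rewrite -nbhs_ballE => -[e /= e0 eA].
apply: (@filterS isometry_group _ (nbhs_filter f) _ _ _
  (isom_eval_near (f^-1%g x) f e0)) => f' /= ff'; apply: eA.
rewrite ballEmdist/=; move: ff'.
by rewrite isomVK -(isom_dist f' (f^-1%g x)) isomVK metric_sym.
Qed.

HB.instance Definition _ := isTopologicalGroup.Build isometry_group
  isom_mulg_continuous isom_invg_continuous.

End isometries.

Record isometric_action (R : realType) (G : groupType) (Y : metricType R) :=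
  IsometricAction {
    iact :> G -> Y -> Y;
    iact1 : forall y, iact 1%g y = y;
    iactM : forall g h y, iact (g * h)%g y = iact g (iact h y);
    iact_dist : forall g x y, mdist (iact g x) (iact g y) = mdist x y
  }.

Definition coarsely_proper (R : realType) (G : topologicalGroupType)
    (Y : metricType R) (a : isometric_action G Y) : Prop :=
  forall (r : R) (y : Y), 0 < r ->
    coarsely_bounded R [set g | mdist (a g y) y < r].

Section orbit_closures.
Variables (R : realType) (G : groupType) (Y : metricType R).
Variable a : isometric_action G Y.

Definition orbit_closure (y : Y) : set Y := closure [set a g y | g in [set: G]].

Record orbit_closure_space : Type := OrbitClosure {
  orbit_closure_set :> set Y;
  orbit_closure_setP : exists y, orbit_closure_set = orbit_closure y
}.

Definition orbit_closure_class (y : Y) : orbit_closure_space :=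
  OrbitClosure (ex_intro (fun z => orbit_closure y = orbit_closure z) y erefl).

(* The distance between two orbit closures as sets; orbit_closure_distE shows
   that on classes of points it is inf_g d(x, g y). *)
Definition orbit_closure_dist (C D : orbit_closure_space) : R :=
  inf [set mdist p.1 p.2 | p in (C : set Y) `*` (D : set Y)].

Lemma orbit_closure_spaceP (C D : orbit_closure_space) :
  C = D :> set Y -> C = D.
Proof.
case: C D => [C CP] [D DP] /= CD; case: D / CD in DP *.
by congr OrbitClosure; exact: Prop_irrelevance.
Qed.

Lemma orbit_closure_spaceE (C : orbit_closure_space) :
  exists y, C = orbit_closure_class y.
Proof.
by have [y Cy] := orbit_closure_setP C; exists y; exact: orbit_closure_spaceP.
Qed.

Lemma iactK g : cancel (a g) (a g^-1%g).
Proof. by move=> y; rewrite -iactM mulVg iact1. Qed.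

Lemma orbit_closureP x y : orbit_closure x y <->
  forall e, 0 < e -> exists g, mdist y (a g x) < e.
Proof.
split=> [xy e e0|xy B].
  have /xy[_ [[g _ <-]]] : nbhs y (ball y e) by exact: nbhsx_ballx.
  by rewrite ballEmdist; exists g.
rewrite -nbhs_ballE => -[e /= e0]; rewrite ballEmdist => yB.
by have [g ge] := xy _ e0; exists (a g x); split; [exists g|exact: yB].
Qed.

Lemma orbit_closure_refl y : orbit_closure y y.
Proof. by apply: subset_closure; exists 1%g => //; rewrite iact1. Qed.

Let orbit_dists x y := [set mdist x (a g y) | g in [set: G]].

Let orbit_dists_lb x y : has_lbound (orbit_dists x y).
Proof. by exists 0 => _ [g _ <-]; exact: mdist_ge0. Qed.

Lemma orbit_closure_distE x y :
  orbit_closure_dist (orbit_closure_class x) (orbit_closure_class y) =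
  inf [set mdist x (a g y) | g in [set: G]].
Proof.
apply/eqP; rewrite eq_le; apply/andP; split.
  apply: lb_le_inf; first by exists (mdist x (a 1%g y)); exists 1%g.
  move=> _ [g _ <-]; apply: ge_inf.
    by exists 0 => _ [p _ <-]; exact: mdist_ge0.
  exists (x, a g y) => //=; split => /=; first exact: orbit_closure_refl.
  by apply: subset_closure; exists g.
apply: lb_le_inf.
  exists (mdist x y); exists (x, y) => //=.
  by split; exact: orbit_closure_refl.
move=> _ [[u v] [/= /orbit_closureP xu /orbit_closureP yv] <-].
apply/ler_addgt0Pl => e e0; have e20 : 0 < e / 2 by rewrite divr_gt0.
have [g gu] := xu _ e20; have [h hv] := yv _ e20.
apply: (@le_trans _ _ (mdist x (a (g^-1 * h)%g y))).
  by apply: (ge_inf (orbit_dists_lb _ _)); exists (g^-1 * h)%g.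
rewrite -(iact_dist a g) -iactM mulVKg.
apply: le_trans (metric_triangle _ u _) _.
rewrite (splitr e) -addrA lerD//; first by rewrite metric_sym ltW.
rewrite addrC; apply: le_trans (metric_triangle _ v _) _.
by rewrite lerD// ltW.
Qed.

Fact orbit_closure_distxx C : orbit_closure_dist C C = 0.
Proof.
have [y ->] := orbit_closure_spaceE C; rewrite orbit_closure_distE.
apply/eqP; rewrite eq_le; apply/andP; split.
  by apply: (ge_inf (orbit_dists_lb _ _)); exists 1%g => //; rewrite iact1 mdistxx.
apply: lb_le_inf; first by exists (mdist y (a 1%g y)); exists 1%g.
by move=> _ [g _ <-]; exact: mdist_ge0.
Qed.

Fact orbit_closure_dist_sym C D :
  orbit_closure_dist C D = orbit_closure_dist D C.
Proof.
congr inf; rewrite eqEsubset.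
by split => _ [[u v] [/= Cu Dv] <-]; exists (v, u) => //=; rewrite metric_sym.
Qed.

Let orbit_dist_lt x y e :
  orbit_closure_dist (orbit_closure_class x) (orbit_closure_class y) < e ->
  exists g, mdist x (a g y) < e.
Proof.
rewrite orbit_closure_distE => /inf_lt[]; last by move=> _ [g _ <-]; exists g.
by exists (mdist x (a 1%g y)); exists 1%g.
Qed.

Fact orbit_closure_dist_triangle D C E :
  orbit_closure_dist C E <= orbit_closure_dist C D + orbit_closure_dist D E.
Proof.
have [x ->] := orbit_closure_spaceE C; have [y ->] := orbit_closure_spaceE D.
have [z ->] := orbit_closure_spaceE E.
have hi u v : has_inf (orbit_dists u v).
  by split => //; exists (mdist u (a 1%g v)); exists 1%g.
rewrite !orbit_closure_distE; apply/ler_addgt0Pl => e e0.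
have e20 : 0 < e / 2 by rewrite divr_gt0.
have [_ [g _ <-] xy] := inf_adherent e20 (hi x y).
have [_ [h _ <-] yz] := inf_adherent e20 (hi y z).
apply: (@le_trans _ _ (mdist x (a (g * h)%g z))).
  by apply: (ge_inf (orbit_dists_lb _ _)); exists (g * h)%g.
apply: le_trans (metric_triangle _ (a g y) _) _.
by rewrite iactM iact_dist [leRHS]addrC [in leRHS](splitr e) addrACA lerD// ltW.
Qed.

Fact orbit_closure_dist_positivity C D : orbit_closure_dist C D = 0 -> C = D.
Proof.
have sub x y : orbit_closure_dist (orbit_closure_class x)
    (orbit_closure_class y) = 0 -> orbit_closure x `<=` orbit_closure y.
  move=> xy0 z /orbit_closureP xz; apply/orbit_closureP => e e0.
  have e20 : 0 < e / 2 by rewrite divr_gt0.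
  have [g zg] := xz _ e20.
  have [h xh] : exists h, mdist x (a h y) < e / 2.
    by apply: orbit_dist_lt; rewrite xy0.
  exists (g * h)%g; apply: le_lt_trans (metric_triangle _ (a g x) _) _.
  by rewrite iactM iact_dist (splitr e) ltrD.
have [x ->] := orbit_closure_spaceE C; have [y ->] := orbit_closure_spaceE D.
move=> xy0; apply: orbit_closure_spaceP; rewrite /= eqEsubset.
by split; apply: sub => //; rewrite orbit_closure_dist_sym.
Qed.

HB.instance Definition _ := gen_eqMixin orbit_closure_space.
HB.instance Definition _ := gen_choiceMixin orbit_closure_space.
HB.instance Definition _ := @isMetric.Build R orbit_closure_space
  orbit_closure_dist orbit_closure_distxx orbit_closure_dist_positivity
  orbit_closure_dist_sym orbit_closure_dist_triangle.

End orbit_closures.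

(* Carries the maximum metric; for n = 0 it is a single point. *)
Definition power_space (n : nat) (X : Type) : Type := {ffun 'I_n -> X}.

Section power_metric.
Variables (R : realType) (X : metricType R) (n : nat).

Implicit Types x y z : power_space n X.

Let power_dist x y : R :=
  \big[Num.max/0]_(i < n) mdist (x i) (y i).

Let power_dist_le x y (M : R) :
  0 <= M -> (forall i, mdist (x i) (y i) <= M) -> power_dist x y <= M.
Proof. by move=> M0 xyM; apply: bigmax_le. Qed.

Let le_power_dist x y i : mdist (x i) (y i) <= power_dist x y.
Proof. exact: le_bigmax. Qed.

Let power_dist_ge0 x y : 0 <= power_dist x y.
Proof. exact: bigmax_ge_id. Qed.

Let power_distxx x : power_dist x x = 0.
Proof.
apply/eqP; rewrite eq_le power_dist_ge0 andbT; apply: power_dist_le => // i.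
by rewrite mdistxx.
Qed.

Let power_dist_positivity x y : power_dist x y = 0 -> x = y.
Proof.
move=> xy0; apply/ffunP => i; apply: mdist_positivity; apply/eqP.
by rewrite eq_le mdist_ge0 andbT -xy0 le_power_dist.
Qed.

Let power_dist_sym x y : power_dist x y = power_dist y x.
Proof. by apply: eq_bigr => i _; rewrite metric_sym. Qed.

Let power_dist_triangle y x z :
  power_dist x z <= power_dist x y + power_dist y z.
Proof.
apply: power_dist_le => [|i]; first by rewrite addr_ge0.
by apply: le_trans (metric_triangle _ (y i) _) _; rewrite lerD.
Qed.

HB.instance Definition _ := Choice.copy (power_space n X) {ffun 'I_n -> X}.
HB.instance Definition _ := @isMetric.Build R (power_space n X)
  power_dist power_distxx power_dist_positivity power_dist_sym
  power_dist_triangle.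

Lemma power_distE (x y : power_space n X) :
  mdist x y = \big[Num.max/0]_(i < n) mdist (x i) (y i).
Proof. by []. Qed.

End power_metric.

Section actions.
Variables (R : realType) (X : metricType R).

Program Definition diagonal_action (G : groupType) (a : isometric_action G X)
    (n : nat) : isometric_action G (power_space n X) :=
  @IsometricAction R G (power_space n X) (fun g x => [ffun i => a g (x i)]) _ _ _.
Next Obligation. by move=> G a n x; apply/ffunP => i; rewrite ffunE iact1. Qed.
Next Obligation.
by move=> G a n g h x; apply/ffunP => i; rewrite !ffunE iactM.
Qed.
Next Obligation.
move=> G a n g x y; rewrite !power_distE.
by apply: eq_bigr => i _; rewrite !ffunE iact_dist.
Qed.

Program Definition evaluation_action (G : groupClosed (isometry_group X)) :
    isometric_action (subgroup G) X :=
  @IsometricAction R (subgroup G) X (fun g x => val g x) _ _ _.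
Next Obligation. by []. Qed.
Next Obligation. by []. Qed.
Next Obligation. by move=> G g x y; rewrite isom_dist. Qed.

End actions.

(* Main.v *)
(* (1) => (3): in a locally Roelcke precompact group the product of two Roelcke
   precompact sets is Roelcke precompact, and separability yields a continuous
   left-invariant word metric on [G] whose balls are contained in finite unions
   of such products; hence coarsely bounded sets are Roelcke precompact.
   (3) => (1): Roelcke precompact sets are coarsely bounded.
   (2) => (3): for a tuple [t], a finite net for the bounded set of the classes
   [(t, g t)], where [g] ranges over [O], gives a finite [F] with [O] inside
   [U F U], where [U] consists of the elements that almost fix [t].
   (3) => (2): [X^n // G] is complete, and finite nets of its bounded sets are
   built one coordinate at a time, writing a boundedly displacing group element
   as [u f v] with [f] in a finite set and [u], [v] almost trivial.  Hence
   (1) => (2) goes through (3). *)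
Require Import Defs.
From mathcomp Require Import all_boot all_order all_algebra.
From mathcomp Require Import all_classical all_reals all_analysis.
From mathcomp Require Import lra.

Set Implicit Arguments.
Unset Strict Implicit.
Unset Printing Implicit Defensive.

Import Order.TTheory GRing.Theory Num.Theory.
Import numFieldNormedType.Exports.

Local Open Scope classical_set_scope.
Local Open Scope ring_scope.

(** * Roelcke precompact sets and their stability properties *)

Section roelcke.
Variable T : topologicalGroupType.
Implicit Types (g h : T) (A B U : set T).

Lemma mulgl_continuous g : continuous (fun h : T => (g * h)%g).
Proof.
move=> h; apply: (@continuous_comp T (T * T)%type T (fun h => (g, h))
  (fun x => (x.1 * x.2)%g)); last exact: mulg_continuous.
by apply: cvg_pair => /=; [exact: cvg_cst|exact: cvg_id].
Qed.

Lemma mulgr_continuous g : continuous (fun h : T => (h * g)%g).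
Proof.
move=> h; apply: (@continuous_comp T (T * T)%type T (fun h => (h, g))
  (fun x => (x.1 * x.2)%g)); last exact: mulg_continuous.
by apply: cvg_pair => /=; [exact: cvg_id|exact: cvg_cst].
Qed.

Lemma nbhs1_mulg U : nbhs (1%g : T) U -> exists2 W : set T, nbhs (1%g : T) W &
  forall u v, W u -> W v -> U (u * v)%g.
Proof.
move=> U1; have /= := @mulg_continuous T (1%g, 1%g) U.
rewrite mul1g => /(_ U1)[[A B] [/= A1 B1] AB].
exists (A `&` B); first exact: filterI.
by move=> u v [Au _] [_ Bv]; exact: (AB (u, v)).
Qed.

Lemma nbhs1_conjg g U : nbhs (1%g : T) U ->
  nbhs (1%g : T) [set w | U (g^-1 * w * g)%g].
Proof.
move=> U1; apply: (@continuous_comp T T T (fun w => g^-1 * w)%g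
    (fun w => w * g)%g 1%g); first exact: mulgl_continuous.
  exact: mulgr_continuous.
by rewrite /= mulg1 mulVg.
Qed.

Lemma roelcke_precompactP A : roelcke_precompact A <->
  forall U, nbhs (1%g : T) U -> exists2 F : set T, finite_set F &
    forall g, A g -> exists u f v, [/\ U u, F f, U v & g = (u * f * v)%g].
Proof.
split=> RA U /RA[F finF FA]; exists F => // g /FA.
  by move=> [[[u f] v] [[/= Uu Ff] Uv] <-]; exists u, f, v.
by move=> [u [f [v [Uu Ff Uv ->]]]]; exists ((u, f), v).
Qed.

Lemma sub_roelcke_precompact A B :
  A `<=` B -> roelcke_precompact B -> roelcke_precompact A.
Proof.
by move=> AB RB U /RB[F finF BF]; exists F => //; exact: subset_trans BF.
Qed.

Lemma roelcke_precompact1 g : roelcke_precompact [set g].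
Proof.
apply/roelcke_precompactP => U U1; exists [set g]; first exact: finite_set1.
move=> _ ->; exists 1%g, g, 1%g; split => //; last by rewrite mulg1 mul1g.
all: exact: nbhs_singleton U1.
Qed.

Lemma bigcup_roelcke_precompact (I : Type) (D : set I) (F : I -> set T) :
  finite_set D -> (forall i, D i -> roelcke_precompact (F i)) ->
  roelcke_precompact (\bigcup_(i in D) F i).
Proof.
move=> finD RF; apply/roelcke_precompactP => U U1.
have {}RF i : exists E : set T, D i -> finite_set E /\
    forall g, F i g -> exists u f v, [/\ U u, E f, U v & g = (u * f * v)%g].
  have [Di|nDi] := pselect (D i); last by exists set0.
  by have /roelcke_precompactP/(_ _ U1)[E] := RF i Di; exists E.
have [E EF] := choice RF; exists (\bigcup_(i in D) E i).
  by apply: bigcup_finite => // i /EF[].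
move=> g [i Di /(EF i Di).2[u [f [v [Uu Ef Uv ->]]]]].
by exists u, f, v; split => //; exists i.
Qed.

(** Write [g * (u * f * v) * h] as [(g * u * g^-1) * (g * f * h) * (h^-1 * v * h)] and take [u] and
    [v] so small that both conjugates fall in [U]. *)
Lemma roelcke_precompact_translate A g h : roelcke_precompact A ->
  roelcke_precompact [set (g * x * h)%g | x in A].
Proof.
move=> /roelcke_precompactP RA; apply/roelcke_precompactP => U U1.
have Ug := nbhs1_conjg g^-1%g U1; have Uh := nbhs1_conjg h U1.
have [F finF AF] := RA _ (filterI Ug Uh).
exists [set (g * x * h)%g | x in F]; first exact: finite_image.
move=> _ [x /AF[u [f [v [[Uu _] Ff [_ Uv] ->]]]] <-].
exists (g^-1^-1 * u * g^-1)%g, (g * f * h)%g, (h^-1 * v * h)%g.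
split => //; first by exists f.
by rewrite invgK !mulgA mulgVK mulgK.
Qed.

(* If [A] and [B] are covered by [W F W] and [W F' W] for a neighbourhood [W]
   with [W W] inside the precompact neighbourhood [V], then [A B] is covered by
   [W F V F' W], where [F V F'] is a finite union of translates of [V]. *)
Lemma roelcke_precompactM A B : locally_roelcke_precompact T ->
  roelcke_precompact A -> roelcke_precompact B ->
  roelcke_precompact [set (x.1 * x.2)%g | x in A `*` B].
Proof.
move=> [V V1 RV] /roelcke_precompactP RA /roelcke_precompactP RB.
apply/roelcke_precompactP => U U1.
have [W W1 WU] := nbhs1_mulg U1; have [W' W'1 W'V] := nbhs1_mulg V1.
have N1 : nbhs (1%g : T) (W `&` W') by exact: filterI.
have [F finF AF] := RA _ N1; have [E finE BE] := RB _ N1.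
have /roelcke_precompactP/(_ _ W1)[H finH FVE] : roelcke_precompact
    (\bigcup_(p in F `*` E) [set (p.1 * x * p.2)%g | x in V]).
  apply: bigcup_roelcke_precompact; first exact: finite_setX.
  by move=> p _; exact: roelcke_precompact_translate.
exists H => // _ [[x y] [/= /AF[u [f [v [[Wu _] Ff [_ W'v] ->]]]]]
  /BE[u' [f' [v' [[_ W'u'] Ef' [Wv' _] ->]]]] <-].
have [|w [k [z [Ww Hk Wz fvf]]]] := FVE (f * (v * u') * f')%g.
  by exists (f, f') => //; exists (v * u')%g => //; exact: W'V.
exists (u * w)%g, k, (z * v')%g; split => //; try exact: WU.
have -> : (u * f * v * (u' * f' * v') = u * (f * (v * u') * f') * v')%g.
  by rewrite !mulgA.
by rewrite fvf !mulgA.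
Qed.

(** With [U] the open unit ball of [d] around the identity, left invariance makes [d 1 (u * f * v)]
    at most [d 1 u + d 1 f + d 1 v], and [f] takes finitely many values. *)
Lemma roelcke_precompact_coarsely_bounded (R : realType) A :
  roelcke_precompact A -> coarsely_bounded R A.
Proof.
move=> /roelcke_precompactP RA d [d0 dxx dsym dtri] dl dc.
have U1 : nbhs (1%g : T) [set g | d 1%g g < 1].
  have /cvgrPdist_lt/(_ _ ltr01)[[P Q] [/= P1 Q1] PQ] := dc (1%g, 1%g).
  apply: filterS Q1 => g Qg /=.
  have := PQ (1%g, g) (conj (nbhs_singleton P1) Qg).
  by rewrite /= dxx sub0r normrN ger0_norm.
have [F /finite_seqP[s ->{F}] AF] := RA _ U1.
pose N := \big[Num.max/0]_(f <- s) d 1%g f.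
have {AF}AN g : A g -> d 1%g g <= N + 2.
  move=> /AF[u [f [v [/= Uu fs Uv ->]]]].
  have fN : d 1%g f <= N by exact: le_bigmax_seq.
  have := dtri 1%g u (u * f * v)%g.
  rewrite -{3}(mulg1 u) -mulgA dl => le1.
  have := dtri 1%g f (f * v)%g; rewrite -{3}(mulg1 f) dl => le2.
  lra.
exists (N + 2 + (N + 2)) => x y /AN Nx /AN Ny.
by apply: le_trans (dtri _ 1%g _) _; rewrite (dsym x) lerD.
Qed.

End roelcke.

(** * Coarsely bounded sets via a weighted word length *)

(* The seminorm witnessing that coarsely bounded sets are Roelcke precompact is
   a weighted word length: an element [s] close to the identity costs
   [delta s], any other one at least [e] and at least [kappa s], where [kappa]
   has Roelcke precompact sublevel sets. *)
Section word_length.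
Variables (T : topologicalGroupType) (R : realType).
Variables (delta : T -> R) (e : R) (kappa : T -> nat).
Hypothesis e_gt0 : 0 < e.
Hypothesis delta_ge0 : forall g, 0 <= delta g.
Hypothesis delta1 : delta 1%g = 0.
Hypothesis deltaV : forall g, delta g^-1%g = delta g.
Hypothesis deltaM : forall g h, delta (g * h)%g <= delta g + delta h.
Hypothesis delta_nbhs : forall r, 0 < r -> nbhs (1%g : T) [set g | delta g < r].
Hypothesis delta_rpc : roelcke_precompact [set g | delta g < e].
Hypothesis kappa_rpc : forall n, roelcke_precompact [set g | (kappa g <= n)%N].

(** Both [kappa s] and [kappa s^-1] are added because [kappa] need not be invariant under inversion,
    whereas the length must be symmetric. *)
Definition letter_cost (s : T) : R :=
  if delta s < e then delta s else e + (kappa s)%:R + (kappa s^-1%g)%:R.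

Definition word_cost (w : seq T) : R := \sum_(s <- w) letter_cost s.

Definition word_eval (w : seq T) : T := \big[*%g/1%g]_(s <- w) s.

Definition word_length (g : T) : R :=
  inf [set word_cost w | w in [set w | word_eval w = g]].

Lemma letter_cost_ge0 s : 0 <= letter_cost s.
Proof.
by rewrite /letter_cost; case: ifP => // _; rewrite !addr_ge0 ?ler0n// ltW.
Qed.

Lemma letter_costV s : letter_cost s^-1%g = letter_cost s.
Proof. by rewrite /letter_cost deltaV invgK addrAC. Qed.

Lemma word_cost_ge0 w : 0 <= word_cost w.
Proof. by apply: sumr_ge0 => s _; exact: letter_cost_ge0. Qed.

Let word_costs g := [set word_cost w | w in [set w | word_eval w = g]].

Let word_costs_inf g : has_inf (word_costs g).
Proof.
split; last by exists 0 => _ [w _ <-]; exact: word_cost_ge0.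
by exists (word_cost [:: g]), [:: g] => //=; rewrite /word_eval big_seq1.
Qed.

Lemma word_length_le w : word_length (word_eval w) <= word_cost w.
Proof. by apply: ge_inf; [exact: (word_costs_inf _).2|exists w]. Qed.

Lemma word_length_lt g r : word_length g < r ->
  exists2 w, word_eval w = g & word_cost w < r.
Proof.
by case/(inf_lt (word_costs_inf g).1) => _ [w wg <-] wr; exists w.
Qed.

Lemma word_length_ge0 g : 0 <= word_length g.
Proof.
apply: lb_le_inf; first exact: (word_costs_inf g).1.
by move=> _ [w _ <-]; exact: word_cost_ge0.
Qed.

Lemma word_length_delta g : delta g < e -> word_length g <= delta g.
Proof.
move=> ge; have := word_length_le [:: g].
by rewrite /word_eval /word_cost !big_seq1 /letter_cost ge.
Qed.

Lemma word_length1 : word_length 1%g = 0.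
Proof.
apply/eqP; rewrite eq_le word_length_ge0 andbT -delta1.
by rewrite word_length_delta// delta1.
Qed.

Lemma word_lengthM g h : word_length (g * h)%g <= word_length g + word_length h.
Proof.
apply/ler_addgt0Pl => r r0; have r20 : 0 < r / 2 by rewrite divr_gt0.
have [w wg wr] : exists2 w, word_eval w = g &
    word_cost w < word_length g + r / 2.
  by apply: word_length_lt; rewrite ltrDl.
have [v vh vr] : exists2 v, word_eval v = h &
    word_cost v < word_length h + r / 2.
  by apply: word_length_lt; rewrite ltrDl.
have := word_length_le (w ++ v).
rewrite /word_eval /word_cost !big_cat /= -!/(word_eval _) -!/(word_cost _).
rewrite wg vh; lra.
Qed.

Lemma word_lengthV g : word_length g^-1%g = word_length g.
Proof.
(* Reversing a word and inverting its letters yields a word of the same cost for the inverse. *)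
suff le h : word_length h^-1%g <= word_length h.
  by apply/eqP; rewrite eq_le le -{1}(invgK g) le.
apply: lb_le_inf; first exact: (word_costs_inf h).1.
move=> _ [w wh <-].
have -> : h^-1%g = word_eval (rev [seq s^-1%g | s <- w]).
  rewrite -wh /word_eval; elim: w {wh} => [|s w IHw] /=.
    by rewrite !big_nil invg1.
  by rewrite big_cons invgM IHw rev_cons -cats1 big_cat /= big_seq1.
apply: le_trans (word_length_le _) _.
rewrite /word_cost (perm_big _ (permEl (perm_rev _))) big_map /=.
by rewrite (eq_bigr letter_cost)// => s _; exact: letter_costV.
Qed.

Definition word_dist (g h : T) : R := word_length (g^-1 * h)%g.

Lemma word_dist_pseudometric : pseudometric word_dist.
Proof.
split=> [x y|x|x y|x y z]; rewrite /word_dist.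
- exact: word_length_ge0.
- by rewrite mulVg word_length1.
- by rewrite -word_lengthV invgM invgK.
- by apply: le_trans (word_lengthM _ _); rewrite mulgA mulgK.
Qed.

Lemma word_dist_left_invariant : left_invariant word_dist.
Proof. by move=> g x y; rewrite /word_dist invgM -mulgA mulKg. Qed.

Lemma word_dist_continuous : continuous (fun p : T * T => word_dist p.1 p.2).
Proof.
move=> [x y]; apply/cvgrPdist_lt => r r0 /=.
(* Below [e] the length is bounded by [delta]; each of the two variables may then contribute
   [r / 2]. *)
pose m := Num.min e (r / 2); have m0 : 0 < m by rewrite lt_min e_gt0 divr_gt0.
have near z : nbhs z [set w | delta (z^-1 * w)%g < m].
  have := @mulgl_continuous T z^-1%g z [set w | delta w < m].
  by rewrite mulVg => /(_ (delta_nbhs m0)).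
exists ([set w | delta (x^-1 * w)%g < m], [set w | delta (y^-1 * w)%g < m]).
  by split; exact: near.
have small z w : delta (z^-1 * w)%g < m -> word_dist z w < r / 2.
  rewrite lt_min => /andP[we wr].
  exact: le_lt_trans (word_length_delta we) wr.
move=> [x' y'] [/= /small xx' /small yy'].
have [_ _ dsym dtri] := word_dist_pseudometric.
have := dtri x x' y; have := dtri x' y' y; have := dtri x' x y'.
have := dtri x y y'; rewrite (dsym x' x) (dsym y' y) => *.
rewrite ltr_norml; apply/andP; split; lra.
Qed.

Let V0 := [set g | delta g < e].

(** A completed step consists of a merged block in [V0] followed by the letter that makes the cost
    reach [e]. *)
Let step (r : R) :=
  [set (x.1 * x.2)%g | x in V0 `*` [set s | letter_cost s <= r]].

Let steps (r : R) (m : nat) : set T :=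
  iter m (fun A => [set (x.1 * x.2)%g | x in A `*` step r]) [set 1%g].

Let delta_lrpc : locally_roelcke_precompact T.
Proof. by exists V0 => //; exact: delta_nbhs. Qed.

Let steps_rpc r m : roelcke_precompact (steps r m).
Proof.
have RK : roelcke_precompact [set s | letter_cost s <= r].
  apply: (@sub_roelcke_precompact _ _ (\bigcup_(b in [set: bool])
    if b then V0 else [set g | (kappa g <= Num.truncn r)%N])).
    move=> s; rewrite /= /letter_cost; case: ifPn => [se _|_ sr].
      by exists true.
    exists false => //=; rewrite truncn_ge_nat; last first.
      by apply: le_trans sr; rewrite !addr_ge0 ?ler0n// ltW.
    by apply: le_trans sr; rewrite addrAC lerDr addr_ge0 ?ler0n// ltW.
  apply: bigcup_roelcke_precompact; first exact: finite_finset.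
  by case.
elim: m => [|m IHm]; first exact: roelcke_precompact1.
by do 2 apply: roelcke_precompactM => //.
Qed.

(* Reading a word from the left, letters are merged into [v] until its cost
   would reach [e]; each completed step thus uses up at least [e]. *)
Let word_steps r w : word_cost w <= r -> exists m h v,
  [/\ steps r m h, delta v < e, word_eval w = (h * v)%g &
      m%:R * e + delta v <= word_cost w].
Proof.
elim/last_ind: w => [|w s IHw].
  move=> _; exists 0%N, 1%g, 1%g.
  rewrite /word_eval /word_cost !big_nil delta1 mul0r addr0 mulg1.
  by split.
rewrite /word_cost /word_eval -cats1 !big_cat /= !big_seq1.
rewrite -/(word_cost _) -/(word_eval _) => wsr.
have s0 := letter_cost_ge0 s; have w0 := word_cost_ge0 w.
have [|m [h [v [mh ve -> mw]]]] := IHw; first lra.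
have v0 := delta_ge0 v.
have [vse|evs] := ltP (delta v + letter_cost s) e.
  (* A letter outside [V0] alone costs at least [e], so here [s] is short and can be merged into
     [v]. *)
  have se : delta s < e.
    move: vse; rewrite /letter_cost; case: ifP => // _.
    by have := ler0n R (kappa s); have := ler0n R (kappa s^-1%g); lra.
  have ss : letter_cost s = delta s by rewrite /letter_cost se.
  have := deltaM v s; exists m, h, (v * s)%g; rewrite mulgA; split => //; lra.
exists m.+1, (h * (v * s))%g, 1%g; rewrite mulg1 mulgA delta1; split => //.
- exists (h, (v * s)%g); last by rewrite /= mulgA.
  split => //=.
  by exists (v, s) => //=; split => //=; lra.
- rewrite -natr1; lra.
Qed.

(** From a base point [b] of [B], every element of [B] is reached by a word of cost below [r], hence
    in at most [r / e] steps and a remainder in [V0]. So [B] lies in a finite union of products of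
    precompact sets. *)
Lemma coarsely_bounded_roelcke_precompact (B : set T) :
  coarsely_bounded R B -> roelcke_precompact B.
Proof.
move=> /(_ _ word_dist_pseudometric word_dist_left_invariant
  word_dist_continuous)[M BM].
have [[b Bb]|/set0P/negP/negPn/eqP ->] := pselect (B !=set0); last first.
  by move=> U _; exists set0; [exact: finite_set0|exact: sub0set].
pose r := M + 1; pose n := (Num.truncn (r / e)).+1.
have RS : roelcke_precompact [set (x.1 * x.2)%g |
    x in [set b] `*` \bigcup_(m in `I_n)
      [set (x.1 * x.2)%g | x in steps r m `*` V0]].
  apply: roelcke_precompactM => //; first exact: roelcke_precompact1.
  apply: bigcup_roelcke_precompact; first exact: finite_II.
  by move=> m _; exact: roelcke_precompactM.
apply: sub_roelcke_precompact RS => g Bg.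
have [|w wg wr] := @word_length_lt (b^-1 * g)%g r.
  by apply: le_lt_trans (BM _ _ Bb Bg) _; rewrite ltrDl.
have [m [h [v [mh ve wE mw]]]] := word_steps (ltW wr).
exists (b, (b^-1 * g)%g) => /=; last by rewrite mulVKg.
split => //=; exists m; last by exists (h, v) => //=; rewrite -wE.
rewrite /= /n ltnS truncn_ge_nat; last first.
  rewrite divr_ge0 ?(ltW e_gt0)//.
  exact: le_trans (word_cost_ge0 w) (ltW wr).
by rewrite ler_pdivlMr//; have := delta_ge0 v; lra.
Qed.

End word_length.

(** * Finite nets, completeness and properness in metric spaces *)

Lemma filter_bigcap_finite (I : choiceType) (T : Type) (F : set_system T)
    (D : set I) (f : I -> set T) : Filter F -> finite_set D ->
  (forall i, D i -> F (f i)) -> F (\bigcap_(i in D) f i).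
Proof. by move=> FF /finite_fsetP[X ->] Ff; exact: filter_bigI. Qed.

Section metric_nets.
Variables (R : realType) (Y : metricType R).

Lemma dist_lt_half (x y z : Y) (e : R) :
  mdist x y < e / 2 -> mdist y z < e / 2 -> mdist x z < e.
Proof.
by move=> xy yz; apply: le_lt_trans (metric_triangle _ y _) _; lra.
Qed.

Lemma closureP (A : set Y) x : closure A x <->
  forall e, 0 < e -> exists2 y, A y & mdist x y < e.
Proof.
split=> [Ax e e0|Ax B].
  have /Ax[y [Ay]] : nbhs x (ball x e) by exact: nbhsx_ballx.
  by rewrite ballEmdist; exists y.
rewrite -nbhs_ballE => -[e /= e0]; rewrite ballEmdist => xB.
by have [y Ay xy] := Ax _ e0; exists y; split => //; exact: xB.
Qed.

Lemma metric_bounded_closure (A : set Y) :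
  metric_bounded A -> metric_bounded (closure A).
Proof.
move=> [M AM]; exists (M + 2) => x y /closureP/(_ _ ltr01)[x' Ax' xx']
  /closureP/(_ _ ltr01)[y' Ay' yy'].
have := AM _ _ Ax' Ay'; have := metric_triangle x x' y.
have := metric_triangle x' y' y; rewrite (metric_sym y' y); lra.
Qed.

Definition totally_bounded (A : set Y) := forall e, 0 < e ->
  exists2 F : set Y, finite_set F &
    forall x, A x -> exists2 y, F y & mdist y x < e.

(** Compactness is available for the closure of [A] only, but each point of the closure is close to
    a point of [A], so the net can be taken inside [A]. *)
Lemma proper_net (A : set Y) e : proper_space Y -> metric_bounded A -> 0 < e ->
  exists2 F : set Y, finite_set F /\ F `<=` A &
    forall x, A x -> exists2 y, F y & mdist y x < e.
Proof.
move=> propY /metric_bounded_closure bA e0.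
have /propY/(_ bA)/compact_near_coveringP cA := @closed_closure _ A.
(* The filter of all sufficiently large finite lists: near-covering compactness turns lists that
   work locally into one that works on the whole closure. *)
pose S : set_system (seq Y) :=
  filter_from setT (fun s => [set s' : seq Y | {subset (s : seq Y) <= s'}]).
have SF : Filter S.
  apply: filter_from_filter => [|s t _ _]; first by exists [::].
  exists (s ++ t) => // u /= stu; split => x xs; apply: stu.
    by rewrite mem_cat xs.
  by rewrite mem_cat xs orbT.
have [|s _ sA] := cA _ _ (fun s x =>
    exists z, [/\ z \in s, A z & mdist z x < e]) SF.
  move=> x /closureP Ax; have e20 : 0 < e / 2 by rewrite divr_gt0.
  have [z Az xz] := Ax _ e20; exists (ball x (e / 2), [set s | z \in s]).
    split; first exact: nbhsx_ballx.
    by exists [:: z] => // s /= ->//; exact: mem_head.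
  move=> [x' s] /= [xx' zs]; exists z; split => //.
  rewrite ballEmdist /= in xx'.
  by apply: (@dist_lt_half _ x) => //; rewrite metric_sym.
exists ([set` s] `&` A); first by split => //; exact: finite_setIl.
move=> x Ax; have [z [zs Az zx]] := sA s (fun _ => id) x (subset_closure Ax).
by exists z.
Qed.

(** An ultrafilter containing [A] must contain one of the finitely many [e]-balls covering [A], for
    otherwise it would contain all their complements. It is therefore Cauchy, and its limit lies in
    the closed set [A]. *)
Lemma complete_totally_bounded_proper : complete_space Y ->
  (forall A : set Y, metric_bounded A -> totally_bounded A) -> proper_space Y.
Proof.
move=> complY netY A clA /netY nA; rewrite compact_ultra => F UF FA.
have [|p Fp] := complY F ultra_proper; last first.
  exists p; split => //; apply: clA => B /Fp FB.
  exact: (filter_ex (filterI FA FB)).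
apply/cauchyP => e e0; have [E finE EA] := nA e e0.
apply: contrapT => /forallNP Fe.
suff : F set0 by exact: filter_not_empty.
have : F (\bigcap_(y in E) ~` ball y e).
  apply: filter_bigcap_finite => // y ys.
  by have [/Fe|] := in_ultra_setVsetC (ball y e) UF.
move=> /(filterI FA); apply: filterS => x [/EA[y ys yx] /(_ y ys)].
by rewrite ballEmdist.
Qed.

Lemma complete_power n : complete_space Y -> complete_space (power_space n Y).
Proof.
move=> complY F PF /cauchyP cF.
have cvgY i : exists y : Y, (fun x : power_space n Y => x i) @ F --> y.
  apply: complY; apply/cauchyP => e e0; have [x Fx] := cF e e0.
  exists (x i); suff : F [set y | ball (x i) e (y i)] by [].
  apply: filterS Fx => y; rewrite !ballEmdist /=.
  apply: le_lt_trans.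
  exact: (le_bigmax 0 (fun i => mdist (x i) (y i))).
have [y yE] := choice cvgY; exists [ffun i => y i].
move=> B; rewrite -nbhs_ballE => -[e /= e0 eB].
have : F (\bigcap_(i in [set: 'I_n])
    [set x : power_space n Y | mdist (y i) (x i) < e]).
  apply: filter_bigcap_finite; first exact: finite_finset.
  move=> i _; apply: (yE i [set z | mdist (y i) z < e]).
  by rewrite -ballEmdist; exact: nbhsx_ballx.
apply: filterS => x xe; apply: eB; rewrite ballEmdist /= power_distE.
apply: bigmax_lt => // i _; rewrite ffunE; exact: xe.
Qed.

End metric_nets.

(** * Distance and completeness in the space of orbit closures *)

Section orbit_closures.
Variables (R : realType) (G : groupType) (Y : metricType R).
Variable a : isometric_action G Y.

Lemma orbit_dist_le x y g :
  mdist (orbit_closure_class a x) (orbit_closure_class a y) <= mdist x (a g y).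
Proof.
rewrite -[leLHS]/(orbit_closure_dist _ _) orbit_closure_distE.
apply: ge_inf; last by exists g.
by exists 0 => _ [h _ <-]; exact: mdist_ge0.
Qed.

Lemma orbit_dist_ltP x y e :
  mdist (orbit_closure_class a x) (orbit_closure_class a y) < e <->
  exists g, mdist x (a g y) < e.
Proof.
split=> [|[g]]; last exact: le_lt_trans (orbit_dist_le _ _ _).
rewrite -[X in X < _]/(orbit_closure_dist _ _) orbit_closure_distE.
case/inf_lt; last by move=> _ [g _ <-]; exists g.
by exists (mdist x (a 1%g y)); exists 1%g.
Qed.

(* A Cauchy filter has centres [C_k] of balls of radius [2^-k]; representatives
   of the [C_k] can be translated, one after the other, into a Cauchy
   sequence. *)
Lemma complete_orbit_closures :
  complete_space Y -> complete_space (orbit_closure_space a).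
Proof.
move=> complY F PF /cauchyP cF.
pose r (k : nat) : R := 2^-1 ^+ k.
have r0 k : 0 < r k by rewrite exprn_gt0// invr_gt0.
have rS k : r k.+1 = r k / 2 by rewrite /r exprSr.
have ex k : exists y, F (ball (orbit_closure_class a y) (r k)).
  have [C FC] := cF _ (r0 k); have [y CE] := orbit_closure_spaceE C.
  by exists y; rewrite -CE.
have [c Fc] := choice ex.
have ex_next k y : exists g, mdist (orbit_closure_class a y)
    (orbit_closure_class a (c k)) = 0 ->
    mdist y (a g (c k.+1)) < 2 * r k.
  have [y0|] := pselect (mdist (orbit_closure_class a y)
    (orbit_closure_class a (c k)) = 0); last by exists 1%g.
  (* Two sets of a proper filter meet, so consecutive centres are less than [r k + r k.+1 < 2 * r k]
     apart. *)
  have [D [yD cD]] := filter_ex (filterI (Fc k) (Fc k.+1)).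
  rewrite !ballEmdist /= in yD cD.
  have /orbit_dist_ltP[g yg] : mdist (orbit_closure_class a y)
      (orbit_closure_class a (c k.+1)) < 2 * r k.
    rewrite (mdist_positivity _ _ y0).
    have := metric_triangle (orbit_closure_class a (c k)) D
      (orbit_closure_class a (c k.+1)).
    have := r0 k; rewrite (metric_sym D); move: cD; rewrite rS; lra.
  by exists g.
have [next nextP] : exists next : nat -> Y -> G, forall k y,
    mdist (orbit_closure_class a y) (orbit_closure_class a (c k)) = 0 ->
    mdist y (a (next k y) (c k.+1)) < 2 * r k.
  have [f fP] := choice (fun ky : nat * Y => ex_next ky.1 ky.2).
  by exists (fun k y => f (k, y)) => k y; exact: (fP (k, y)).
pose fix u k : Y := if k is k'.+1 then a (next k' (u k')) (c k) else c 0%N.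
have uc k :
    mdist (orbit_closure_class a (u k)) (orbit_closure_class a (c k)) = 0.
  apply/eqP; rewrite eq_le mdist_ge0 andbT; case: k => [|k] /=.
    by rewrite mdistxx.
  rewrite metric_sym; apply: le_trans (orbit_dist_le _ _ (next k (u k))^-1%g) _.
  by rewrite /= iactK mdistxx.
(* The bound telescopes, because [2 * r k = 4 * r k - 4 * r k.+1]. *)
have uu k m : mdist (u k) (u (k + m)%N) <= 4 * r k - 4 * r (k + m)%N.
  elim: m => [|m IHm]; first by rewrite addn0 mdistxx subrr.
  have := metric_triangle (u k) (u (k + m)%N) (u (k + m).+1).
  have := nextP (k + m)%N _ (uc _); rewrite addnS rS /=; lra.
have rsmall e : 0 < e -> exists k, r k < e.
  move=> e0; have e1 : 0 < e^-1 by rewrite invr_gt0.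
  exists (Num.bound e^-1).
  rewrite -[ltRHS]invrK /r exprVn ltf_pV2 ?posrE ?exprn_gt0//.
  apply: lt_trans (archi_boundP (ltW e1)) _.
  by rewrite -natrX ltr_nat ltn_expl.
have [|y uy] := complY (u @ \oo) _.
  apply/cauchyP => e e0; have e40 : 0 < e / 4 by rewrite divr_gt0.
  have [k rk] := rsmall _ e40; exists (u k); exists k => // m /= km.
  rewrite ballEmdist /= -(subnKC km); apply: le_lt_trans (uu _ _) _.
  by have := r0 (k + (m - k))%N; lra.
exists (orbit_closure_class a y) => B; rewrite -nbhs_ballE => -[e /= e0 eB].
have e20 : 0 < e / 2 by rewrite divr_gt0.
have [k rk] := rsmall _ e20.
have [N _ Ny] : \forall n \near \oo, mdist y (u n) < e / 2.
  have := uy (ball y (e / 2)) (nbhsx_ballx _ _ e20).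
  by rewrite ballEmdist.
pose m := maxn N k; have rm : r m <= r k.
  by rewrite /r ler_wiXn2l ?leq_maxr ?invr_ge0 ?invf_le1 ?ler1n.
apply: filterS (Fc m) => C; rewrite ballEmdist => mC.
apply: eB; rewrite ballEmdist.
apply: (@dist_lt_half _ _ _ (orbit_closure_class a (c m))).
  rewrite -(mdist_positivity _ _ (uc m)); apply/orbit_dist_ltP; exists 1%g.
  by rewrite iact1; apply: Ny; exact: leq_maxl.
exact: lt_trans mC (le_lt_trans rm rk).
Qed.

End orbit_closures.

(** * Actions for which the displacement sets of finite tuples form a neighbourhood base at the
    identity *)

Section continuous_actions.
Variables (R : realType) (T : topologicalGroupType) (X : metricType R).
Variable a : isometric_action T X.
Hypothesis act_near : forall x e, 0 < e ->
  nbhs (1%g : T) [set g | mdist x (a g x) < e].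
Hypothesis act_basis : forall U, nbhs (1%g : T) U ->
  exists s : seq X, exists2 e : R, 0 < e &
    forall g, (forall x, x \in s -> mdist x (a g x) < e) -> U g.

Lemma nbhs1_act (A : set X) e : finite_set A -> 0 < e ->
  nbhs (1%g : T) [set g | forall x, A x -> mdist x (a g x) < e].
Proof.
move=> finA e0.
have : nbhs (1%g : T) (\bigcap_(x in A) [set g | mdist x (a g x) < e]).
  by apply: filter_bigcap_finite => // x _; exact: act_near.
by apply: filterS => g gA x; exact: gA.
Qed.

Lemma mdist_iactV g x : mdist x (a g^-1%g x) = mdist x (a g x).
Proof. by rewrite -(iact_dist a g) -iactM mulgV iact1 metric_sym. Qed.

Lemma mdist_iactM g h x :
  mdist x (a (g * h)%g x) <= mdist x (a g x) + mdist x (a h x).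
Proof.
apply: le_trans (metric_triangle _ (a g x) _) _.
by rewrite iactM iact_dist.
Qed.

Definition displacement_lt (x : X) (r : R) : set T :=
  [set g | mdist x (a g x) < r].

(* Two translates [g t] and [k t] of a tuple [t] are within [e] up to an element
   moving [t] by less than [e] as soon as the pairs [(t, g t)] and [(t, k t)]
   are [e]-close modulo the action. *)
Lemma displacement_lt_roelcke_precompact :
  (forall n, proper_space (orbit_closure_space (diagonal_action a n))) ->
  forall x r, roelcke_precompact (displacement_lt x r).
Proof.
move=> propX x r; apply/roelcke_precompactP => U /act_basis[s [e e0 sU]].
pose n := size s; pose t (j : 'I_n) : X := tnth (in_tuple s) j.
have tU g : (forall j, mdist (t j) (a g (t j)) < e) -> U g.
  by move=> gt; apply: sU => y /seq_tnthP[j ->]; exact: gt.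
pose P (g : T) : power_space (n + n) X :=
  [ffun i : 'I_(n + n) =>
    match fintype.split i with inl j => t j | inr j => a g (t j) end].
have Pl g j : P g (lshift n j) = t j.
  by rewrite ffunE -[lshift n j]/(unsplit (inl j)) unsplitK.
have Pr g j : P g (rshift n j) = a g (t j).
  by rewrite ffunE -[rshift n j]/(unsplit (inr j)) unsplitK.
pose C g := orbit_closure_class (diagonal_action a (n + n)) (P g).
have bC : metric_bounded [set C g | g in displacement_lt x r].
  pose M := \big[Num.max/0]_(j < n) mdist (t j) x.
  (* The path from [g t] through [g x], [x] and [h x] to [h t] has length at most [M + r + r + M];
     the absolute value covers negative [r]. *)
  exists (`|2 * r + 2 * M|) => _ _ [g gx <-] [h hx <-].
  apply: le_trans (orbit_dist_le _ _ _ 1%g) _; rewrite iact1 power_distE.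
  apply: bigmax_le; first exact: normr_ge0.
  move=> i _; rewrite !ffunE; case: fintype.split => j; first by rewrite mdistxx.
  have tx : mdist (t j) x <= M by exact: le_bigmax.
  apply: le_trans (ler_norm _); apply: le_trans (metric_triangle _ (a g x) _) _.
  have := metric_triangle (a g x) (a h x) (a h (t j)).
  have := metric_triangle (a g x) x (a h x).
  rewrite !iact_dist (metric_sym x (t j)) (metric_sym (a g x) x).
  by move: gx hx; rewrite /displacement_lt /=; lra.
have [F [finF FC] Cnet] := proper_net (propX _) bC e0.
have [k kP] : exists k, forall c, F c -> C (k c) = c.
  have kx c : exists g, F c -> C g = c.
    have [/FC[g _ <-]|] := pselect (F c); first by exists g.
    by exists 1%g.
  by have [k kP] := choice kx; exists k.
exists (k @` F); first exact: finite_image.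
move=> g gx; have [|c Fc] := Cnet (C g); first by exists g.
rewrite -(kP c Fc) metric_sym => /orbit_dist_ltP[h]; rewrite power_distE => gk.
have {}gk i : mdist (P g i) (a h (P (k c) i)) < e.
  apply: le_lt_trans gk.
  have := le_bigmax 0 (fun i => mdist (P g i)
    (diagonal_action a (n + n) h (P (k c)) i)) i.
  by rewrite /= [X in mdist _ X]ffunE.
(* The first half of the coordinates says that [h] almost fixes [t]; the second says that [g t] is
   close to [h (k c) t], so the last factor almost fixes [t] too. *)
exists h, (k c), ((k c)^-1 * h^-1 * g)%g; split.
- by apply: tU => j; have := gk (lshift n j); rewrite !Pl.
- by exists c.
- apply: tU => j; have := gk (rshift n j); rewrite !Pr -iactM.
  rewrite -(iact_dist a ((k c)^-1 * h^-1)%g) -!iactM -!mulgA mulKg mulVg iact1.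
  by rewrite metric_sym !mulgA.
- by rewrite !mulgA mulgK mulgV mul1g.
Qed.

Section proper_powers.
Hypothesis X_complete : complete_space X.
Hypothesis X_proper : proper_space (orbit_closure_space a).
Hypothesis displacement_rpc : forall x r,
  roelcke_precompact (displacement_lt x r).

(** The classes of the points of a ball form a bounded set in the proper quotient; [F] consists of
    representatives of a finite net of it. *)
Lemma orbit_net (p : X) M e : 0 < e -> exists2 F : set X, finite_set F &
  forall x, mdist p x <= M -> exists y g, F y /\ mdist x (a g y) < e.
Proof.
move=> e0.
pose A := [set orbit_closure_class a x | x in [set x | mdist p x <= M]].
have [|F [finF FA] AF] := proper_net X_proper (A := A) _ e0.
  exists (M + M) => _ _ [x px <-] [y py <-].
  apply: le_trans (orbit_dist_le _ _ _ 1%g) _; rewrite iact1.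
  apply: le_trans (metric_triangle _ p _) _.
  by rewrite lerD // metric_sym.
have [f fP] := choice (@orbit_closure_spaceE _ _ _ a).
exists (f @` F); first exact: finite_image.
move=> x px; have [|c Fc] := AF (orbit_closure_class a x); first by exists x.
rewrite {1}(fP c) metric_sym => /orbit_dist_ltP[g xg].
by exists (f c), g; split => //; exists c.
Qed.

(* The [k]-th coordinate is handled once the first [k] ones are within [e] of a
   translate [g z]: then [g^-1 x_k] is close to some [h y] with [h] moving [y]
   boundedly, and [h = u f v] with [f] from a finite set, [u] almost fixing [z]
   and [v] almost fixing [y], so that [g u] works with [f y] as new
   coordinate. *)
Lemma power_partial_net n (p : power_space n X) M k : (k <= n)%N ->
  forall e, 0 < e -> exists2 F : set (power_space n X), finite_set F &
    exists B, forall x, mdist p x <= M -> exists z g, [/\ F z,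
      forall i, mdist (p i) (a g (p i)) <= B &
      forall i : 'I_n, (i < k)%N -> mdist (x i) (a g (z i)) < e].
Proof.
elim: k => [_ e e0|k IHk kn e e0].
  exists [set p]; first exact: finite_set1.
  exists 0 => x _; exists p, 1%g; split => // i.
  by rewrite iact1 mdistxx.
have e20 : 0 < e / 2 by rewrite divr_gt0.
have [F finF [B FB]] := IHk (ltnW kn) _ e20.
pose i0 := Ordinal kn.
have [Y finY Ynet] := orbit_net (p i0) (B + M) e20.
(* The first condition preserves the approximation of the earlier coordinates and of the new one;
   the second lets the displacement bound for [p] grow only from [B] to [B + 1]. *)
pose U (zy : power_space n X * X) : set T := [set g | forall x,
  (range zy.1 `|` [set zy.2]) x -> mdist x (a g x) < e / 2] `&`
  [set g | forall x, range p x -> mdist x (a g x) < 1].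
have U1 zy : nbhs (1%g : T) (U zy).
  apply: filterI; apply: nbhs1_act => //.
    rewrite finite_setU; split; last exact: finite_set1.
    by apply: finite_image; exact: finite_finset.
  by apply: finite_image; exact: finite_finset.
(* This bounds the displacement of [y] by [h], going through [p i0] and [g^-1 x_k]. *)
pose r (y : X) := mdist y (p i0) + B + M + e.
have exH zy : exists H : set T, finite_set H /\
    forall g, displacement_lt zy.2 (r zy.2) g ->
      exists u f v, [/\ U zy u, H f, U zy v & g = (u * f * v)%g].
  have /roelcke_precompactP/(_ _ (U1 zy))[H finH HP] :=
    displacement_rpc zy.2 (r zy.2).
  by exists H.
have [H HP] := choice exH.
pose upd (z : power_space n X) w : power_space n X :=
  [ffun i => if i == i0 then w else z i].
exists (\bigcup_(zy in F `*` Y) [set upd zy.1 (a f zy.2) | f in H zy]).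
  apply: bigcup_finite; first exact: finite_setX.
  by move=> zy _; apply: finite_image; exact: (HP zy).1.
exists (B + 1) => x px; have [z [g [Fz gp gz]]] := FB x px.
have pxi i : mdist (p i) (x i) <= M.
  by apply: le_trans px; rewrite power_distE; exact: le_bigmax.
have [|y [h [Yy xh]]] := Ynet (a g^-1%g (x i0)).
  rewrite -(iact_dist a g) -iactM mulgV iact1.
  apply: le_trans (metric_triangle _ (p i0) _) _.
  by rewrite metric_sym lerD.
have [|u [f [v [[/= uU up] Hf [/= vU _] hE]]]] := (HP (z, y)).2 h.
  rewrite /displacement_lt /r /=.
  have : mdist (p i0) (a g^-1%g (x i0)) <= B + M.
    rewrite -(iact_dist a g) -iactM mulgV iact1.
    apply: le_trans (metric_triangle _ (p i0) _) _.
    by rewrite metric_sym lerD.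
  have := metric_triangle y (p i0) (a h y).
  have := metric_triangle (p i0) (a g^-1%g (x i0)) (a h y); lra.
exists (upd z (a f y)), (g * u)%g; split.
- by exists (z, y) => //; exists f.
- move=> i; apply: le_trans (mdist_iactM _ _ _) _.
  by apply: lerD => //; apply: ltW; apply: up; exists i.
move=> i ik; rewrite ffunE; have [->|ii0] := eqVneq i i0.
  apply: (@dist_lt_half _ _ _ (a g (a h y))).
    by rewrite -(iact_dist a g^-1%g) iactK.
  rewrite iactM iact_dist hE !iactM !iact_dist metric_sym.
  by apply: vU; right.
apply: (@dist_lt_half _ _ _ (a g (z i))).
  apply: gz; rewrite ltn_neqAle -ltnS ik andbT.
  by apply: contra ii0 => /eqP ik'; apply/eqP/val_inj.
by rewrite iactM iact_dist; apply: uU; left; exists i.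
Qed.

Lemma proper_power_orbit_closures n :
  proper_space (orbit_closure_space (diagonal_action a n)).
Proof.
apply: complete_totally_bounded_proper.
  by apply: complete_orbit_closures; exact: complete_power.
move=> A [M AM] e e0.
have [[C0 AC0]|/set0P/negP/negPn/eqP ->] := pselect (A !=set0); last first.
  by exists set0; [exact: finite_set0|].
have [p C0E] := orbit_closure_spaceE C0.
(* The extra 1 gives a strict inequality, so that some translate of a representative is actually
   within [M + 1] of [p]. *)
have [F finF [B FB]] := power_partial_net p (M + 1) (leqnn n) e0.
exists [set orbit_closure_class (diagonal_action a n) z | z in F].
  exact: finite_image.
move=> C AC; have [y CE] := orbit_closure_spaceE C.
have /orbit_dist_ltP[g gy] : mdist (orbit_closure_class (diagonal_action a n) p)
    (orbit_closure_class (diagonal_action a n) y) < M + 1.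
  by rewrite -C0E -CE; apply: le_lt_trans (AM _ _ AC0 AC) _; rewrite ltrDl.
have [z [h [Fz _ hz]]] := FB _ (ltW gy).
exists (orbit_closure_class (diagonal_action a n) z); first by exists z.
rewrite CE metric_sym; apply/orbit_dist_ltP; exists (g^-1 * h)%g.
rewrite -(iact_dist (diagonal_action a n) g) -iactM mulVKg power_distE.
by apply: bigmax_lt => // i _; rewrite [X in mdist _ X]ffunE; exact: hz.
Qed.

End proper_powers.

Lemma displacement_lt_coarsely_proper :
  (forall x r, roelcke_precompact (displacement_lt x r)) -> coarsely_proper a.
Proof.
move=> RD r x _; apply: roelcke_precompact_coarsely_bounded.
by apply: sub_roelcke_precompact (RD x r) => g /=; rewrite metric_sym.
Qed.

Lemma displacement_lt_locally_roelcke_precompact :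
  (forall x r, roelcke_precompact (displacement_lt x r)) ->
  locally_roelcke_precompact T.
Proof.
move=> RD; have [[x _]|X0] := pselect ([set: X] !=set0).
  by exists (displacement_lt x 1) => //; exact: act_near.
(* If [X] is empty, the displacement conditions are vacuous and every neighbourhood of the identity
   is the whole group. *)
exists setT; first exact: filterT.
move=> U /act_basis[s [e e0 sU]]; exists [set 1%g]; first exact: finite_set1.
have UT g : U g by apply: sU => x _; case: X0; exists x.
by move=> g _; exists ((1%g, 1%g), g); rewrite ?mul1g.
Qed.

End continuous_actions.

(** * Separability and the passage from coarse boundedness to Roelcke precompactness *)

Section separable_actions.
Variables (R : realType) (T : topologicalGroupType) (X : metricType R).
Variable a : isometric_action T X.
Hypothesis act_near : forall x e, 0 < e ->
  nbhs (1%g : T) [set g | mdist x (a g x) < e].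
Hypothesis act_basis : forall U, nbhs (1%g : T) U ->
  exists s : seq X, exists2 e : R, 0 < e &
    forall g, (forall x, x \in s -> mdist x (a g x) < e) -> U g.
Hypothesis X_separable : separable_space X.

(** The code of [g] records, for each [x] in [s], a point of a countable dense set near [g x]. *)
Lemma exists_code (s : seq X) e : 0 < e -> exists kappa : T -> nat,
  forall g h, kappa g = kappa h ->
    forall x, x \in s -> mdist (a g x) (a h x) < e.
Proof.
move=> e0; have [D /countable_injP[f finj] denseD] := X_separable.
have near x : exists q, D q /\ mdist x q < e / 2.
  have xb : nbhs x (ball x (e / 2)) by apply: nbhsx_ballx; rewrite divr_gt0.
  have [|q [qb Dq]] := denseD _ _ (open_interior (ball x (e / 2))).
    by exists x.
  by exists q; split => //; have := interior_subset qb; rewrite ballEmdist.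
have [q qP] := choice near.
exists (fun g => pickle [seq f (q (a g x)) | x <- s]) => g h.
move=> /(pcan_inj (@pickleK _))/eq_in_map gh x xs.
have [Dg qg] := qP (a g x); have [Dh qh] := qP (a h x).
apply: dist_lt_half qg _; rewrite metric_sym.
suff -> : q (a g x) = q (a h x) by [].
by apply: finj; rewrite ?inE//; exact: gh.
Qed.

(** The word length is built from [delta], the largest displacement of a point of [s], whose
    [e]-ball lies in the precompact [V]. Elements with the same code as [k] lie in the translate of
    this ball by [k], so the sublevel sets of [kappa] are precompact. *)
Lemma coarsely_proper_displacement_lt :
  locally_roelcke_precompact T -> coarsely_proper a ->
  forall x r, 0 < r -> roelcke_precompact (displacement_lt a x r).
Proof.
move=> [V /act_basis[s [e e0 sV]] RV] cpa x r r0.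
have [kappa kappaP] := exists_code s e0.
pose delta g : R := \big[Num.max/0]_(x <- s) mdist x (a g x).
have delta_ge y g : y \in s -> mdist y (a g y) <= delta g.
  by move=> ys; exact: (le_bigmax_seq 0 y xpredT (fun y => mdist y (a g y))).
have delta0 g : 0 <= delta g by exact: bigmax_ge_id.
have delta_lt g c : 0 < c -> (forall y, y \in s -> mdist y (a g y) < c) ->
    delta g < c.
  by move=> c0 gc; rewrite /delta big_seq; exact: bigmax_lt.
have delta_le g c : 0 <= c -> (forall y, y \in s -> mdist y (a g y) <= c) ->
    delta g <= c.
  by move=> c0 gc; rewrite /delta big_seq; exact: bigmax_le.
have RV0 : roelcke_precompact [set g | delta g < e].
  apply: sub_roelcke_precompact RV => g ge; apply: sV => y ys.
  exact: le_lt_trans (delta_ge _ _ ys) ge.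
apply: (@coarsely_bounded_roelcke_precompact T R delta e kappa) => //.
- apply/eqP; rewrite eq_le delta0 andbT; apply: delta_le => // y _.
  by rewrite iact1 mdistxx.
- by move=> g; apply: eq_bigr => y _; exact: mdist_iactV.
- move=> g h; apply: delta_le => [|y ys]; first exact: addr_ge0.
  by apply: le_trans (mdist_iactM _ _ _ _) _; apply: lerD; exact: delta_ge.
- move=> c c0; apply: filterS (nbhs1_act act_near (finite_seq s) c0) => g gc.
  exact: delta_lt.
- move=> n; apply: (@sub_roelcke_precompact _ _
    (\bigcup_(m in `I_n.+1) [set g | kappa g = m])).
    by move=> g gn; exists (kappa g).
  apply: bigcup_roelcke_precompact; first exact: finite_II.
  move=> m _; have [[k km]|] := pselect (exists k, kappa k = m); last first.
    move=> nk; apply: (@sub_roelcke_precompact _ _ [set 1%g]) => [g gm|].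
      by case: nk; exists g.
    exact: roelcke_precompact1.
  apply: sub_roelcke_precompact (roelcke_precompact_translate k 1%g RV0).
  move=> g gm; exists (k^-1 * g)%g; last by rewrite mulg1 mulVKg.
  apply: delta_lt => // y ys; rewrite -(iact_dist a k) -iactM mulVKg.
  by apply: kappaP => //; rewrite km.
- rewrite (_ : displacement_lt a x r = [set g | mdist (a g x) x < r]).
    exact: cpa.
  by apply/seteqP; split => g; rewrite /displacement_lt /= metric_sym.
Qed.

End separable_actions.

(** * Neighbourhoods of the identity for pointwise convergence *)

Section isometry_subgroups.
Variables (R : realType) (X : metricType R).
Variable G : groupClosed (isometry_group X).

Lemma isometry_group_nbhs1 (U : set (isometry_group X)) :
  nbhs (1%g : isometry_group X) U -> exists s : seq X, exists2 e : R, 0 < e &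
    forall f : isometry_group X,
      (forall x, x \in s -> mdist x (f x) < e) -> U f.
Proof.
move=> [_ [[B Bop <-] B1 BU]].
(* The filter of displacement conditions on arbitrary maps converges pointwise to the identity, so
   every open neighbourhood [B] of it contains a basic set. *)
pose F : set_system (X -> X) := filter_from [set p : seq X * R | 0 < p.2]
  (fun p => [set f | forall x, x \in p.1 -> mdist x (f x) < p.2]).
have FF : Filter F.
  apply: filter_from_filter => [|[s e] [t d] /= e0 d0].
    by exists ([::], 1); exact: ltr01.
  exists (s ++ t, Num.min e d); first by rewrite /= lt_min e0.
  move=> f /= fst; split => x xs.
    by have := fst x; rewrite mem_cat xs lt_min => /(_ isT)/andP[].
  by have := fst x; rewrite mem_cat xs orbT lt_min => /(_ isT)/andP[].
have Fid : F --> (idfun : {ptws X -> X}).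
  apply/cvg_sup => x; apply/cvg_image.
    by rewrite eqEsubset; split => // y _; exists (fun=> y).
  move=> A; rewrite -nbhs_ballE => -[e /= e0 eA]; exists [set f | A (f x)].
    exists ([:: x], e) => //= f fx; apply: eA; rewrite ballEmdist.
    by apply: fx; exact: mem_head.
  by rewrite eqEsubset; split => [_ [f ? <-]//|y Ay]; exists (fun=> y).
have /Fid[[s e] /= e0 sB] : nbhs (idfun : {ptws X -> X}) B.
  exact: open_nbhs_nbhs.
by exists s; exists e => // f fs; apply: BU; exact: sB.
Qed.

Lemma evaluation_action_basis (U : set (subgroup G)) :
  nbhs (1%g : subgroup G) U -> exists s : seq X, exists2 e : R, 0 < e &
    forall g, (forall x, x \in s -> mdist x (evaluation_action G g x) < e) ->
      U g.
Proof.
move=> [_ [[B Bop <-] B1 BU]].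
have [|s [e e0 sB]] := @isometry_group_nbhs1 B; first exact: open_nbhs_nbhs.
by exists s; exists e => // g gs; apply: BU; exact: sB.
Qed.

Lemma evaluation_action_near x e : 0 < e ->
  nbhs (1%g : subgroup G) [set g | mdist x (evaluation_action G g x) < e].
Proof.
move=> e0; apply: (@subgroup_val_continuous _ G 1%g
  [set f : isometry_group X | mdist x (f x) < e]).
exact: (@isom_eval_near _ _ x 1%g).
Qed.

End isometry_subgroups.

Theorem theorem1p10 (R : realType) (X : metricType R)
    (G : groupClosed (isometry_group X))
    (X_complete : complete_space X) (X_separable : separable_space X)
    (G_closed : closed [set f : isometry_group X | f \in G])
    (XG_proper : proper_space (orbit_closure_space (evaluation_action G))) :
  [<-> locally_roelcke_precompact (subgroup G) /\
         coarsely_proper (evaluation_action G);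
       forall n : nat, proper_space
         (orbit_closure_space (diagonal_action (evaluation_action G) n));
       forall (x : X) (r : R), 0 < r ->
         roelcke_precompact
           [set g : subgroup G | mdist x (evaluation_action G g x) < r]].
Proof.
have near := @evaluation_action_near R X G.
have basis := @evaluation_action_basis R X G.
(* Displacement sets increase with [r], so replacing [r] by [Num.max r 1] removes the positivity
   condition. *)
have rpc_all : (forall x r, 0 < r ->
      roelcke_precompact (displacement_lt (evaluation_action G) x r)) ->
    forall x r, roelcke_precompact (displacement_lt (evaluation_action G) x r).
  move=> RD x r; apply: sub_roelcke_precompact (RD x (Num.max r 1) _).
    by move=> g; rewrite /displacement_lt /= lt_max => ->.
  by rewrite lt_max ltr01 orbT.
tfae.
- move=> [lrpc cp]; apply: proper_power_orbit_closures => //.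
  by apply: rpc_all; exact: coarsely_proper_displacement_lt.
- by move=> propX x r _; exact: displacement_lt_roelcke_precompact.
- move=> /rpc_all RD; split.
    exact: displacement_lt_locally_roelcke_precompact RD.
  exact: displacement_lt_coarsely_proper RD.
Qed.
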